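(* There exists an absolute constant $C>0$ such that for all integers $\Delta\ge 2$ and $\omega\ge 2$, every graph $G$ of maximum degree at most $\Delta$ with no clique of size greater than $\omega$ satisfies \[ \chi_\ell(G)\le C\,\Delta\sqrt{\frac{\ln(\omega)}{\ln(\Delta)}}. \]
   Context: $\chi_\ell(G)$ denotes the list-chromatic number (choice number) of $G$: the least $k$ such that $G$ has a proper coloring from the lists $L(v)$ for every assignment of lists $L$ with $|L(v)|\ge k$ for all $v$. *)

(* Defs.v *)
From HB Require Import structures.
From mathcomp Require Import all_boot all_order all_algebra.
From mathcomp Require Import all_classical all_reals all_analysis.

Set Implicit Arguments.
Unset Strict Implicit.
Unset Printing Implicit Defensive.

Record sgraph := SGraph {
  vertex :> finType;
  adj : rel vertex;
  adj_sym : symmetric adj;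
  adj_irrefl : irreflexive adj
}.

Definition max_degree (G : sgraph) : nat :=
  \max_(v : G) #|[set u : G | adj v u]|.

Definition is_clique (G : sgraph) (A : {set G}) : Prop :=
  {in A &, forall u v, u != v -> adj u v}.

Definition proper_coloring (G : sgraph) (K : Type) (f : G -> K) : Prop :=
  forall u v : G, adj u v -> f u <> f v.

(* A finite graph with finite lists uses finitely many colors in total, so the
   palette K is taken to be a finite type. *)
Definition choosable (G : sgraph) (k : nat) : Prop :=
  forall (K : finType) (L : G -> {set K}),
    (forall v, k <= #|L v|) ->
    exists f : G -> K, (forall v, f v \in L v) /\ proper_coloring f.

Lemma choosable_card (G : sgraph) : choosable G #|G|.
Proof.
move=> K L hL.
have L0 v : exists x, x \in L v.
  by apply/card_gt0P; apply: leq_trans (hL v); apply/card_gt0P; exists v.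
have [f0 hf0] := boolp.choice L0.
suff [f fL fI] : exists2 f : G -> K, (forall v, f v \in L v) &
    {in enum G &, injective f}.
  exists f; split=> // u v uv fuv.
  have uE : u = v by apply: fI => //; rewrite mem_enum.
  by rewrite uE adj_irrefl in uv.
have := enum_uniq G; have := leqnn (size (enum G)).
rewrite -[X in _ <= X]cardE.
elim: (enum G) => [|a s IHs] /= szs; first by exists f0.
move=> /andP[as' us]; have [f fL fI] := IHs (ltnW szs) us.
have /card_gt0P[x] : 0 < #|L a :\: [set f v | v in s]|.
  rewrite cardsD subn_gt0; apply: leq_trans (hL a).
  apply: leq_ltn_trans (subset_leq_card (subsetIr _ _)) _.
  apply: leq_ltn_trans (leq_imset_card _ _) _.
  by apply: leq_ltn_trans szs; apply: card_size.
rewrite inE => /andP[xs xL].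
have xNf v : v \in s -> x <> f v.
  by move=> vs xE; move/imsetP: xs; apply; exists v.
exists (fun v => if v == a then x else f v) => [v|u v].
  by case: eqP => [->|].
rewrite !inE; case: (eqVneq u a) => [->|ua]; case: (eqVneq v a) => [->|va] //=.
- by move=> _ vs /(xNf _ vs).
- by move=> us' _ /esym /(xNf _ us').
- exact: fI.
Qed.

Lemma ex_choosable (G : sgraph) : exists k, `[< choosable G k >].
Proof. by exists #|G|; apply/asboolP; exact: choosable_card. Qed.

Definition list_chromatic_number (G : sgraph) : nat := ex_minn (ex_choosable G).

(* Main.v *)
(** The colouring is found in two steps.  Consider all proper partial colourings from
the lists, uniformly weighted, and fix the colouring outside the neighbourhood [N(v)].
For each colour [c], conditionally on everything else, the set of neighbours of [v]
coloured [c] is a uniform independent set of some [W] inside [N(v)].  Since cliques have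
size at most [omega], a Ramsey-type count shows that either [W] has at most
[M = (4 omega) ^ (6 b^2)] independent sets, in which case [c] is unused with
probability at least [1 / M], or half of them have size at least [b].  The latter
can happen for at most [Delta / b] colours, so with lists of size [k = 8 Delta / b], except
with tiny probability, [v] keeps at least [2 t] available colours, where [t] is about
[k / (16 M)].  A vertex with that many available colours is blank with probability about
[1 / (2 t)], so with overwhelming probability fewer than [t] such neighbours of [v] are
blank.  The lopsided local lemma yields a partial colouring good at every vertex, and
it extends greedily.  Taking [b] of order [sqrt (ln Delta / ln omega)] gives [M] a small
power of [Delta]. *)
Require Import Defs.
From HB Require Import structures.
From mathcomp Require Import all_classical all_reals all_analysis.
From mathcomp Require Import all_boot all_order all_algebra.
From mathcomp Require Import zify ring lra.

Set Implicit Arguments.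
Unset Strict Implicit.
Unset Printing Implicit Defensive.
Import Order.TTheory GRing.Theory Num.Theory.

(** * Counting independent sets under a clique bound *)

Lemma card_bigcup_le (I T : finType) (P : pred I) (F : I -> {set T}) :
  #|\bigcup_(i | P i) F i| <= \sum_(i | P i) #|F i|.
Proof.
elim/big_rec2: _ => [|i n A _ IH]; first by rewrite cards0.
by apply: leq_trans (leq_card_setU _ _) _; rewrite leq_add2l.
Qed.

Section IndependentSets.
Variables (T : finType) (e : rel T).
Hypotheses (e_sym : symmetric e) (e_irr : irreflexive e).

Implicit Types (W X Y A : {set T}) (a u : T) (s b w : nat).

Definition indep X := [forall x in X, forall y in X, ~~ e x y].

Definition clique A := [forall x in A, forall y in A, (x != y) ==> e x y].

Definition indeps W := [set X : {set T} | (X \subset W) && indep X].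

Definition indepn W s := [set X in indeps W | #|X| == s].

Definition nonnbr W a := [set u in W | (u != a) && ~~ e a u].

Lemma indepP X : reflect {in X &, forall x y, ~~ e x y} (indep X).
Proof.
apply: (iffP forall_inP) => [h x y hx hy|h x hx]; first by have /forall_inP := h x hx; apply.
by apply/forall_inP => y hy; exact: h.
Qed.

Lemma cliqueP A : reflect {in A &, forall x y, x != y -> e x y} (clique A).
Proof.
apply: (iffP forall_inP) => [h x y hx hy xy|h x hx].
  by have /forall_inP /(_ y hy) /implyP := h x hx; apply.
by apply/forall_inP => y hy; apply/implyP; exact: h.
Qed.

Lemma indep0 : indep set0.
Proof. by apply/indepP => x y; rewrite inE. Qed.

Lemma set0_indeps W : set0 \in indeps W.
Proof. by rewrite inE sub0set indep0. Qed.

Lemma indepU1 a X : indep X -> {in X, forall u, ~~ e a u} -> indep (a |: X).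
Proof.
move=> /indepP hX ha; apply/indepP => x y.
rewrite !inE => /orP[/eqP->|hx] /orP[/eqP->|hy]; rewrite ?e_irr ?ha //.
  by rewrite e_sym ha.
exact: hX.
Qed.

(* A maximal clique inside [Low] meets every closed non-neighbourhood, so
   its few members cannot all have small non-neighbourhoods. *)
Lemma card_small_nonnbr W (Low : {set T}) w : 0 < w ->
  (forall A, clique A -> #|A| <= w) ->
  {in Low, forall a, 2 * w * (#|nonnbr W a|).+1 <= #|W|} ->
  Low \subset W -> 2 * #|Low| <= #|W|.
Proof.
move=> w0 hw hLow sLW.
pose P A := (A \subset Low) && clique A.
have P0 : P set0 by rewrite /P sub0set; apply/cliqueP => x y; rewrite inE.
have [A /maxsetP[/andP[sAL cA] maxA] _] := maxset_exists P0.
have cov : Low \subset \bigcup_(a in A) (a |: nonnbr W a).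
  apply/subsetP => u uL; apply/bigcupP.
  case: (boolP [exists a in A, ~~ e a u]) => [/exists_inP[a aA nau]|].
    exists a => //; rewrite !inE (subsetP sLW _ uL) nau andbT /=.
    by case: eqP.
  move=> /exists_inPn hA; exists u; last by rewrite !inE eqxx.
  have eAu a : a \in A -> e a u by move=> /hA; rewrite negbK.
  rewrite -(maxA (u |: A)) ?setU11 ?subsetUr // /P subUset sub1set uL sAL /=.
  apply/cliqueP => x y; rewrite !inE => /orP[/eqP->|hx] /orP[/eqP->|hy] //.
  - by rewrite eqxx.
  - by move=> _; rewrite e_sym eAu.
  - by move=> _; rewrite eAu.
  - exact: (cliqueP _ cA).
have h1 : #|Low| <= \sum_(a in A) (#|nonnbr W a|).+1.
  apply: leq_trans (subset_leq_card cov) _.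
  apply: leq_trans (card_bigcup_le _ _) _.
  by apply: leq_sum => a _; rewrite cardsU1; case: (_ \notin _); rewrite ?add0n ?add1n.
have h2 : 2 * w * #|Low| <= w * #|W|.
  apply: leq_trans (leq_mul (leqnn _) h1) _.
  rewrite big_distrr /=.
  apply: leq_trans (_ : \sum_(a in A) #|W| <= _).
    by apply: leq_sum => a aA; apply: hLow; exact: (subsetP sAL).
  by rewrite sum_nat_const leq_mul // hw.
by rewrite -(leq_pmul2l w0) mulnA [w * 2]mulnC.
Qed.

(** Double counting: adding [a] to an independent set of its non-neighbourhood gives an independent
    set containing [a], and a set of size [s.+1] arises at most once for each of its elements. *)
Lemma sum_indepn_nonnbr W s :
  \sum_(a in W) #|indepn (nonnbr W a) s| <= s.+1 * #|indepn W s.+1|.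
Proof.
have h a : a \in W ->
    #|indepn (nonnbr W a) s| <= #|[set X in indepn W s.+1 | a \in X]|.
  move=> aW; rewrite -(card_in_imset (f := fun Y => a |: Y)); last first.
    move=> Y Z; rewrite !inE => /andP[/andP[sY _] _] /andP[/andP[sZ _] _] eYZ.
    have nY : a \notin Y by apply/negP => /(subsetP sY); rewrite !inE eqxx andbF.
    have nZ : a \notin Z by apply/negP => /(subsetP sZ); rewrite !inE eqxx andbF.
    by rewrite -(setU1K nY) eYZ setU1K.
  apply: subset_leq_card; apply/subsetP => X /imsetP[Y].
  rewrite !inE => /andP[/andP[sY iY] /eqP cY] ->.
  rewrite setU11 andbT subUset sub1set aW /=.
  have nY : a \notin Y by apply/negP => /(subsetP sY); rewrite !inE eqxx andbF.
  rewrite cardsU1 nY cY eqxx andbT.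
  apply/andP; split.
    by apply: subset_trans sY _; apply/subsetP => u; rewrite inE => /andP[].
  apply: indepU1 => // u /(subsetP sY); by rewrite !inE => /and3P[].
apply: leq_trans (leq_sum _ h) _.
have -> : \sum_(a in W) #|[set X in indepn W s.+1 | a \in X]| =
    \sum_(a in W) \sum_(X in indepn W s.+1 | a \in X) 1.
  by apply: eq_bigr => a _; rewrite -sum1_card; apply: eq_bigl => X; rewrite inE.
rewrite (exchange_big_dep (mem (indepn W s.+1))) /=; last by move=> ? ? _ /andP[].
rewrite mulnC -sum_nat_const; apply: leq_sum => X XI.
move: (XI); rewrite inE => /andP[_ /eqP cX].
rewrite sum1_card -[X in _ <= X]cX; apply: subset_leq_card.
by apply/subsetP => u /andP[_ /andP[]].
Qed.

(** Induction on [s]: by [card_small_nonnbr], at least half of the vertices of [W] have a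
    non-neighbourhood of size at least [#|W| / (4 * w)]. Apply the induction hypothesis inside each
    of them and sum by [sum_indepn_nonnbr]. The losses [2] and [s.+1] are absorbed by one more
    factor [(4 * w) ^ s.+1]. *)
Lemma card_indepn_ge w s W : 0 < w ->
  (forall A, clique A -> #|A| <= w) ->
  (4 * w) ^ s <= #|W| ->
  #|W| ^ s <= (4 * w) ^ (s * s) * #|indepn W s|.
Proof.
move=> w0 hw; elim: s W => [|s IH] W hW.
  rewrite muln0 !expn0 mul1n; apply/card_gt0P; exists set0.
  by rewrite inE set0_indeps cards0.
set Q := 4 * w in IH hW *; set n := #|W| in hW *.
have Q0 : 0 < Q by rewrite /Q; lia.
pose High := [set a in W | n < 2 * w * (#|nonnbr W a|).+1].
have hHigh : n <= 2 * #|High|.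
  have : 2 * #|W :\: High| <= n.
    apply: (card_small_nonnbr w0 hw); last exact: subsetDl.
    by move=> a; rewrite !inE negb_and => /andP[/orP[/negP//|]]; rewrite -leqNgt.
  have := cardsID High W.
  rewrite (setIidPr _); last by apply/subsetP => a; rewrite inE => /andP[].
  rewrite -/n; lia.
have hn4 : 4 * w <= n.
  by apply: leq_trans hW; rewrite expnS leq_pmulr // expn_gt0 Q0.
have hJ a : a \in High -> n ^ s <= Q ^ (s * s + s) * #|indepn (nonnbr W a) s|.
  rewrite inE => /andP[aW ha].
  (* The successor in the definition of [High] costs [2 * w], which is at most [n / 2] by [hn4];
     this turns the factor [2 * w] into [4 * w]. *)
  have hn' : n <= Q * #|nonnbr W a| by rewrite /Q; nia.
  have /IH h : Q ^ s <= #|nonnbr W a|.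
    by rewrite -(leq_pmul2l Q0) -expnS (leq_trans hW).
  apply: leq_trans (_ : (Q * #|nonnbr W a|) ^ s <= _).
    by case: (s) => // s'; rewrite leq_exp2r.
  by rewrite expnMn [s * s + s]addnC expnD -mulnA leq_mul.
have h1 : #|High| * n ^ s <= Q ^ (s * s + s) * (s.+1 * #|indepn W s.+1|).
  rewrite -sum_nat_const.
  apply: leq_trans (leq_sum _ hJ) _.
  rewrite -big_distrr /= leq_mul //.
  apply: leq_trans (sum_indepn_nonnbr W s).
  rewrite [X in _ <= X](bigID (mem High)) /= -[X in X <= _]addn0 leq_add //.
  apply: eq_leq; apply: eq_bigl => a; rewrite !inE.
  by case: (a \in W).
have h2 : 2 * s.+1 <= Q ^ s.+1.
  apply: leq_trans (_ : 2 ^ 1 * 2 ^ s.+1 <= _).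
    by rewrite expn1 leq_mul // ltnW // ltn_expl.
  apply: leq_trans (_ : 4 ^ s.+1 <= _); last by rewrite leq_exp2r // /Q; lia.
  by rewrite -expnD -[4]/(2 ^ 2) -expnM leq_exp2l //; lia.
rewrite expnS; apply: leq_trans (_ : 2 * (#|High| * n ^ s) <= _).
  by rewrite mulnA leq_mul.
apply: leq_trans (leq_mul (leqnn 2) h1) _.
have -> : s.+1 * s.+1 = (s * s + s) + s.+1 by lia.
by rewrite [Q ^ (_ + s.+1)]expnD mulnCA -[X in _ <= X]mulnA leq_mul // mulnA leq_mul.
Qed.

Lemma card_small_subsets W b :
  #|[set X : {set T} | (X \subset W) && (#|X| <= b)]| <= (#|W|).+1 ^ b.
Proof.
elim: b => [|b IH].
  rewrite expn0 -(cards1 (@set0 T)); apply: subset_leq_card.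
  by apply/subsetP => X; rewrite !inE leqn0 cards_eq0 => /andP[].
set S := [set X : {set T} | _] in IH.
have sub : [set X : {set T} | (X \subset W) && (#|X| <= b.+1)] \subset
    S :|: \bigcup_(a in W) [set a |: X | X in S].
  apply/subsetP => X; rewrite !inE => /andP[sX cX].
  rewrite sX /=; case: leqP => //= hX; apply/bigcupP.
  have /card_gt0P[a aX] : 0 < #|X| by lia.
  exists a; first exact: (subsetP sX).
  apply/imsetP; exists (X :\ a); last by rewrite setD1K.
  rewrite inE (subset_trans (subsetDl _ _)) //.
  by move: cX; rewrite (cardsD1 a) aX.
apply: leq_trans (subset_leq_card sub) _.
apply: leq_trans (leq_card_setU _ _) _.
rewrite expnS mulSn leq_add //.
apply: leq_trans (card_bigcup_le _ _) _.
apply: leq_trans (_ : \sum_(a in W) #|S| <= _).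
  by apply: leq_sum => a _; exact: leq_imset_card.
by rewrite sum_nat_const leq_mul.
Qed.

(** Compare [#|W|] with [Q ^ (4 * b).+1], where [Q = 4 * w]. Above it, the independent sets of size
    [2 * b] alone outnumber all sets of size at most [b]. Below it there are at most
    [Q ^ ((4 * b).+1 * b)] sets smaller than [b], so if these are the majority the total is at most
    [Q ^ (6 * (b * b))]. *)
Lemma indeps_few_or_large w b W : 0 < w -> 0 < b ->
  (forall A, clique A -> #|A| <= w) ->
  (#|indeps W| <= (4 * w) ^ (6 * (b * b))) \/
  (#|indeps W| <= 2 * #|[set X in indeps W | b <= #|X|]|).
Proof.
move=> w0 b0 hw; set Q := 4 * w; set n := #|W|.
have Q1 : 1 < Q by rewrite /Q; lia.
set big := [set X in indeps W | b <= #|X|].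
set small := indeps W :\: big.
have split : #|indeps W| = #|big| + #|small|.
  rewrite -(cardsID big) (setIidPr _) //.
  by apply/subsetP => X; rewrite inE => /andP[].
have hsmall : #|small| <= n.+1 ^ b.
  apply: leq_trans (card_small_subsets W b); apply: subset_leq_card.
  apply/subsetP => X; rewrite !inE negb_and -ltnNge.
  by case: (X \subset W) => //=; case: indep => //= /andP[/ltnW].
case: (leqP (Q ^ (4 * b).+1) n) => hn.
  right; suff : n.+1 ^ b <= #|big| by lia.
  have Q2b : Q ^ (2 * b) <= n by apply: leq_trans hn; rewrite leq_exp2l //; lia.
  have J := card_indepn_ge w0 hw Q2b.
  apply: leq_trans (_ : #|indepn W (2 * b)| <= _); last first.
    apply: subset_leq_card; apply/subsetP => X; rewrite !inE => /andP[-> /eqP->].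
    lia.
  have P0 : 0 < Q ^ (2 * b * (2 * b)) by rewrite expn_gt0; lia.
  rewrite -(leq_pmul2l P0); apply: leq_trans J; rewrite -/n.
  have -> : 2 * b * (2 * b) = (4 * b) * b by lia.
  rewrite [Q ^ (4 * b * b)]expnM [n ^ (2 * b)]expnM -expnMn leq_exp2r //.
  have n0 : 0 < n by apply: leq_trans hn; rewrite expn_gt0; lia.
  apply: leq_trans (_ : Q ^ (4 * b) * (Q * n) <= _); first by rewrite leq_mul // ltn_Pmull.
  by rewrite mulnA -[X in _ * X * _]expn1 -expnD addn1 -mulnn leq_mul.
case: (leqP #|small| #|big|) => hb; first by right; lia.
left; rewrite split.
have h1 : #|small| <= Q ^ ((4 * b).+1 * b).
  by apply: leq_trans hsmall _; rewrite expnM leq_exp2r.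
apply: leq_trans (_ : Q * Q ^ ((4 * b).+1 * b) <= _); first by nia.
by rewrite -expnS leq_exp2l //; nia.
Qed.

End IndependentSets.

(** * Fibre counting and the lopsided local lemma *)

Lemma sum_card_fiber_le (A B : finType) (D : {set A}) (P : {set B}) (h : A -> B) :
  \sum_(y in P) #|[set x in D | h x == y]| <= #|D|.
Proof.
rewrite -[X in _ <= X]sum1_card (partition_big h predT) //=.
rewrite [X in _ <= X](bigID (mem P)) /= -[X in X <= _]addn0 leq_add //.
apply: leq_sum => y _; rewrite -sum1_card; apply: eq_leq.
by apply: eq_bigl => x; rewrite inE.
Qed.

(** Probabilities are ratios of cardinalities in [D]. Given that any set of far events is avoided,
    [bad v] has probability at most [1 / N]; induction on [#|S|] shows that adding near events to
    the conditioning at most doubles this bound. *)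
Lemma lopsided_local_lemma (A I : finType) (D : {set A}) (bad : I -> pred A)
    (near : rel I) (d N : nat) :
  let good (S : {set I}) := [set f in D | [forall u in S, ~~ bad u f]] in
  (forall v (S : {set I}), {in S, forall u, ~~ near v u} ->
     N * #|[set f in good S | bad v f]| <= #|good S|) ->
  (forall v, #|[set u | near v u]| <= d) ->
  4 * d <= N -> 2 < N -> 0 < #|D| ->
  exists2 f, f \in D & forall v, ~~ bad v f.
Proof.
move=> good hfar hd dN N2 D0.
have goodS (S S' : {set I}) : S' \subset S -> good S \subset good S'.
  move=> sS; apply/subsetP => f; rewrite !inE => /andP[-> /forall_inP h] /=.
  by apply/forall_inP => u /(subsetP sS) /h.
have key v (S : {set I}) : N * #|[set f in good S | bad v f]| <= 2 * #|good S|.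
  have [m] := ubnP #|S|; elim: m v S => // m IH v S hm.
  pose far := [set u in S | ~~ near v u].
  have sF : far \subset S by apply/subsetP => u; rewrite inE => /andP[].
  have h1 : N * #|[set f in good S | bad v f]| <= #|good far|.
    apply: leq_trans (hfar v far _); last by move=> u; rewrite inE => /andP[].
    rewrite leq_mul // subset_leq_card //; apply/subsetP => f.
    by rewrite !inE => /andP[/andP[-> /forall_inP h] ->]; rewrite andbT;
      apply/forall_inP => u /(subsetP sF) /h.
  apply: leq_trans h1 _.
  case: (eqVneq far S) => [->|neq]; first by lia.
  have ltF : #|far| < #|S| by apply: proper_card; rewrite properEneq neq.
  have cov : good far \subset good S :|:
      \bigcup_(u in [set u | near v u]) [set f in good far | bad u f].
    apply/subsetP => f fF; rewrite in_setU; case: (boolP (f \in good S)) => //= nS.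
    move: (fF); rewrite inE => /andP[fD /forall_inP hF].
    move: nS; rewrite inE fD /= => /forall_inPn[u uS /negPn bu].
    apply/bigcupP; exists u; last by rewrite inE fF.
    rewrite inE; apply/negPn/negP => nu.
    by have := hF u; rewrite !inE uS nu bu => /(_ isT).
  have h2 : #|good far| <=
      #|good S| + \sum_(u in [set u | near v u]) #|[set f in good far | bad u f]|.
    apply: leq_trans (subset_leq_card cov) _.
    apply: leq_trans (leq_card_setU _ _) _.
    by rewrite leq_add2l card_bigcup_le.
  have h3 : N * \sum_(u in [set u | near v u]) #|[set f in good far | bad u f]|
      <= d * (2 * #|good far|).
    rewrite big_distrr /=.
    apply: leq_trans (_ : \sum_(u in [set u | near v u]) (2 * #|good far|) <= _).
      by apply: leq_sum => u _; apply: IH; lia.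
    by rewrite sum_nat_const leq_mul.
  (* Since [4 * d <= N], the near events cover at most half of [good far], so [good S] keeps at
     least half of it. *)
  nia.
(* Avoiding one more event loses at most a fraction [2 / N < 1]. *)
have pos (S : {set I}) : 0 < #|good S|.
  have [m] := ubnP #|S|; elim: m S => // m IH S hm.
  have [->|[v vS]] := set_0Vmem S.
    apply: leq_trans D0 _; apply: subset_leq_card; apply/subsetP => f fD.
    by rewrite inE fD; apply/forall_inP => u; rewrite inE.
  have {}IH : 0 < #|good (S :\ v)|.
    by apply: IH; move: hm; rewrite (cardsD1 v) vS; lia.
  have := key v (S :\ v).
  suff : #|good (S :\ v)| <= #|good S| + #|[set f in good (S :\ v) | bad v f]| by nia.
  apply: leq_trans (leq_card_setU _ _); apply: subset_leq_card.
  apply/subsetP => f fG; rewrite in_setU !inE; move: (fG); rewrite inE => /andP[fD /forall_inP hf].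
  rewrite fD /=; case: (boolP (bad v f)) => bv.
    by rewrite andbT; apply/orP; right; apply/forall_inP.
  apply/orP; left; apply/forall_inP => u uS.
  by case: (eqVneq u v) => [->|uv] //; apply: hf; rewrite !inE uv.
have /card_gt0P[f] := pos [set: I].
rewrite inE => /andP[fD /forall_inP h]; exists f => // v.
by apply: h; rewrite inE.
Qed.

(** * Partial list colourings and their blank vertices *)

Section PartialColorings.
Variables (T K : finType) (e : rel T) (L : T -> {set K}).
Hypotheses (e_sym : symmetric e) (e_irr : irreflexive e).

Notation pcol := {ffun T -> option K}.
Implicit Types (f g : pcol) (u v x : T) (c : K) (D : {set pcol}) (X : {set T}).

Definition pproper f := [forall u, forall c, (f u == Some c) ==>
  (c \in L u) && [forall x, e u x ==> (f x != Some c)]].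

Lemma pproperP f :
  reflect (forall u c, f u = Some c -> c \in L u /\ forall x, e u x -> f x != Some c)
          (pproper f).
Proof.
apply: (iffP forallP) => [h u c fu|h u].
  have /forallP/(_ c)/implyP := h u; rewrite fu eqxx => /(_ isT) /andP[cL /forallP hx].
  by split=> // x ux; have /implyP := hx x; apply.
apply/forallP => c; apply/implyP => /eqP /h[-> hx] /=.
by apply/forallP => x; apply/implyP; exact: hx.
Qed.

Definition avail f v := [set c in L v | [forall u, e v u ==> (f u != Some c)]].

Lemma availP f v c :
  reflect (c \in L v /\ forall u, e v u -> f u != Some c) (c \in avail f v).
Proof.
rewrite inE; apply: (iffP andP) => [[cL /forallP h]|[cL h]]; split=> //.
  by move=> u vu; have /implyP := h u; apply.
by apply/forallP => u; apply/implyP; exact: h.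
Qed.

Definition upd f u (o : option K) : pcol := [ffun x => if x == u then o else f x].

Lemma pproper_upd f u c : pproper f -> c \in avail f u -> pproper (upd f u (Some c)).
Proof.
move=> /pproperP pf /availP[cL hc]; apply/pproperP => w d; rewrite ffunE.
case: (eqVneq w u) => [->[<-]|wu fw].
  split=> // x ux; rewrite ffunE; case: (eqVneq x u) => [xu|_]; last exact: hc.
  by rewrite xu e_irr in ux.
have [dL hd] := pf _ _ fw; split=> // x wx; rewrite ffunE.
case: (eqVneq x u) => [xu|_]; last exact: hd.
apply/eqP => -[cd]; have := hc w; rewrite e_sym -xu wx fw cd eqxx.
by move=> /(_ isT).
Qed.

Lemma card_avail_upd f u o v : f u = None -> #|avail f v| <= #|avail (upd f u o) v| + e v u.
Proof.
move=> fu; case: (boolP (e v u)) => vu; last first.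
  rewrite addn0; apply: subset_leq_card; apply/subsetP => c /availP[cL h].
  apply/availP; split=> // x vx; rewrite ffunE; case: (eqVneq x u) => [xu|_]; last exact: h.
  by rewrite -xu vx in vu.
case: o => [d|]; last first.
  rewrite (_ : upd f u None = f) ?leq_addr //; apply/ffunP => x; rewrite ffunE.
  by case: eqP => // ->.
apply: leq_trans (_ : #|d |: avail (upd f u (Some d)) v| <= _).
  apply: subset_leq_card; apply/subsetP => c /availP[cL h]; rewrite in_setU1.
  case: (eqVneq c d) => //= cd; apply/availP; split=> // x vx; rewrite ffunE.
  case: (x == u); last exact: h.
  by apply/eqP => -[dc]; rewrite dc eqxx in cd.
rewrite cardsU1 addnC leq_add2l //.
by case: (_ \notin _).
Qed.

Definition blanks f v := [set u | e v u && (f u == None)].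

(** Give a blank vertex [u] any available colour: each blank neighbour of [u] loses at most one
    available colour and also one blank neighbour, so the strict inequality persists. *)
Lemma greedy_extension f : pproper f ->
  (forall v, f v = None -> #|blanks f v| < #|avail f v|) ->
  exists g : T -> K, (forall v, g v \in L v) /\ (forall u v, e u v -> g u <> g v).
Proof.
have [m] := ubnP #|[set v | f v == None]|; elim: m f => // m IH f hm pf hf.
have [h0|[u]] := set_0Vmem [set v | f v == None].
  have all v : exists c, f v = Some c.
    case E: (f v) => [c|]; first by exists c.
    by have /setP/(_ v) := h0; rewrite !inE E.
  have [g hg] := fin_all_exists all.
  exists g; split=> [v|u v uv guv].
    by have [] := (pproperP _ pf) _ _ (hg v).
  by have [_ /(_ v uv)] := (pproperP _ pf) _ _ (hg u); rewrite guv hg eqxx.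
rewrite inE => /eqP fu.
have /card_gt0P[c cu] : 0 < #|avail f u| by apply: leq_trans (hf u fu).
apply: (IH (upd f u (Some c))).
- apply: leq_trans (_ : #|[set v | f v == None]| <= _); last by lia.
  apply: proper_card; apply/properP; split.
    apply/subsetP => x; rewrite !inE ffunE; by case: (eqVneq x u).
  by exists u; rewrite !inE ?fu // ffunE eqxx.
- exact: pproper_upd.
- move=> v; rewrite ffunE; case: (eqVneq v u) => // vu fv.
  have := hf v fv; have := card_avail_upd (Some c) v fu.
  suff : #|blanks (upd f u (Some c)) v| + e v u <= #|blanks f v| by lia.
  rewrite [X in _ <= X](cardsD1 u) inE fu eqxx andbT addnC leq_add2l.
  apply: subset_leq_card; apply/subsetP => x; rewrite !inE ffunE.
  by case: (eqVneq x u) => //=; rewrite andbF.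
Qed.

Definition nbr v := [set u | e v u].

(** Stands for an event determined by the colours outside the neighbourhood of [v]: counting in [D]
    is conditioning on such an event, with the colours around [v] left free subject to
    properness. *)
Definition closed_at v D := D \subset [set f | pproper f] /\
  forall f g, f \in D -> pproper g -> (forall u, ~~ e v u -> f u = g u) -> g \in D.

(* Colouring the blank vertices of [s] one after the other is injective and offers
   at least [t] choices each time. *)
Lemma card_many_blanks v D t (s : seq T) : closed_at v D -> uniq s -> all (e v) s ->
  #|[set f in D | all (fun u => (f u == None) && (t + size s <= #|avail f u|)) s]|
    * t ^ size s <= #|D|.
Proof.
move=> [DO clD]; elim: s => [|u s IH].
  move=> _ _; rewrite expn0 muln1; apply: subset_leq_card.
  by apply/subsetP => f; rewrite inE => /andP[].
rewrite /= => /andP[us Us] /andP[vu vs]; have {IH} := IH Us vs.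
set Ds := [set f in D | _] => hDs; set Du := [set f in D | _].
suff : t * #|Du| <= #|Ds|.
  move=> h; apply: leq_trans hDs.
  by rewrite expnS mulnA [_ * t]mulnC leq_mul.
apply: leq_trans (sum_card_fiber_le Ds Du (fun f => upd f u None)).
rewrite mulnC -sum_nat_const; apply: leq_sum => f.
rewrite inE => /andP[fD /andP[/andP[/eqP fu avu] /allP fs]].
apply: leq_trans (_ : #|avail f u| <= _); first by apply: leq_trans avu; rewrite leq_addr.
rewrite -(card_imset (f := fun c => upd f u (Some c))); last first.
  by move=> c d /ffunP/(_ u); rewrite !ffunE eqxx => -[].
have pf : pproper f by have := subsetP DO _ fD; rewrite inE.
apply: subset_leq_card; apply/subsetP => g /imsetP[c cu ->]; rewrite !inE -andbA.
apply/and3P; split.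
- apply: (clD f) => //; first exact: pproper_upd.
  move=> x vx; rewrite ffunE; case: (eqVneq x u) => [xu|_]; last by [].
  by rewrite xu vu in vx.
- apply/allP => x xs; have /andP[/eqP fx ax] := fs x xs.
  rewrite ffunE; case: (eqVneq x u) => [xu|_]; first by rewrite -xu xs in us.
  (* Colouring [u] costs [x] at most one available colour, which matches the drop of the threshold
     by one when [u] leaves the list. *)
  rewrite fx eqxx /=; have := card_avail_upd (Some c) x fu.
  have : e x u <= 1 by case: (e x u).
  move: ax => /=; lia.
- apply/eqP/ffunP => x; rewrite !ffunE; by case: (eqVneq x u) => [->|].
Qed.

(** Union bound over the [t]-subsets [X] of the neighbourhood, each treated by [card_many_blanks];
    the threshold [2 * t] is [t + #|X|]. *)
Lemma card_many_blank_nbrs v D t : closed_at v D ->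
  #|[set f in D | t <= #|[set u in blanks f v | 2 * t <= #|avail f u|]|]| * t ^ t
    <= 'C(#|nbr v|, t) * #|D|.
Proof.
move=> clD; pose DT X := [set f in D |
  all (fun u => (f u == None) && (t + size (enum X) <= #|avail f u|)) (enum X)].
have cov : [set f in D | t <= #|[set u in blanks f v | 2 * t <= #|avail f u|]|]
    \subset \bigcup_(X in [set X : {set T} | X \subset nbr v & #|X| == t]) DT X.
  apply/subsetP => f; rewrite inE => /andP[fD ht]; apply/bigcupP.
  have : 0 < 'C(#|[set u in blanks f v | 2 * t <= #|avail f u|]|, t) by rewrite bin_gt0.
  rewrite -cards_draws => /card_gt0P[X]; rewrite inE => /andP[sX /eqP cX].
  exists X.
    rewrite inE cX eqxx andbT; apply: subset_trans sX _.
    by apply/subsetP => x; rewrite !inE => /andP[/andP[]].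
  rewrite inE fD /=; apply/allP => x; rewrite mem_enum => /(subsetP sX).
  by rewrite !inE -cardE cX addnn -mul2n => /andP[/andP[_ ->] ->].
apply: leq_trans (leq_mul (subset_leq_card cov) (leqnn _)) _.
apply: leq_trans (leq_mul (card_bigcup_le _ _) (leqnn _)) _.
rewrite big_distrl /= -cards_draws -sum_nat_const; apply: leq_sum => X.
rewrite inE => /andP[sX /eqP cX].
have := @card_many_blanks v D t (enum X) clD (enum_uniq _).
rewrite /DT -cardE cX => h; apply: h; apply/allP => x; rewrite mem_enum => /(subsetP sX).
by rewrite inE.
Qed.

(** * Resampling one colour around a vertex *)

Definition cls v f c := [set u | e v u && (f u == Some c)].

Definition erase v c f : pcol :=
  [ffun u => if e v u && (f u == Some c) then None else f u].

Definition paint c g X : pcol := [ffun u => if u \in X then Some c else g u].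

Definition paintable v c g :=
  [set u | [&& e v u, g u == None, c \in L u & [forall x, e u x ==> (g x != Some c)]]].

Lemma erase_eq v c f u d : erase v c f u = Some d -> f u = Some d.
Proof. by rewrite ffunE; case: ifP. Qed.

Lemma cls_erase v c d f : d != c -> cls v (erase v c f) d = cls v f d.
Proof.
move=> dc; apply/setP => u; rewrite !inE ffunE; case: (e v u) => //=.
case: (eqVneq (f u) (Some c)) => [->|] //=.
by have /negbTE-> : Some c != Some d by apply: contraNneq dc => -[->].
Qed.

(** Once everything but the positions of [c] around [v] is fixed, these positions can be any
    independent set of the paintable neighbours. The uniform measure on [D] thus becomes uniform on
    independent sets. *)
Lemma erase_fiber v c D f0 : closed_at v D -> f0 \in D ->
  let g := erase v c f0 in
  [set f in D | erase v c f == g] = paint c g @: indeps e (paintable v c g).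
Proof.
move=> [DO clD] f0D g.
have pf0 : pproper f0 by have := subsetP DO _ f0D; rewrite inE.
have gN u : e v u -> g u != Some c.
  by move=> vu; rewrite ffunE vu /=; case: (eqVneq (f0 u) (Some c)).
apply/setP => f; rewrite inE; apply/andP/imsetP => [[fD /eqP fg]|[X]].
  have pf : pproper f by have := subsetP DO _ fD; rewrite inE.
  exists (cls v f c).
    rewrite inE; apply/andP; split.
      apply/subsetP => u; rewrite !inE => /andP[vu /eqP fu].
      have [cL hc] := (pproperP _ pf) _ _ fu.
      rewrite vu cL -fg {1}/erase ffunE vu fu eqxx /=.
      apply/forallP => x; apply/implyP => ux; apply/eqP => /erase_eq fx.
      by have := hc x ux; rewrite fx eqxx.
    apply/indepP => x y; rewrite !inE => /andP[_ /eqP fx] /andP[_ /eqP fy].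
    apply/negP => xy; have [_ /(_ y xy)] := (pproperP _ pf) _ _ fx.
    by rewrite fy eqxx.
  apply/ffunP => u; rewrite ffunE inE -fg ffunE.
  by case: (boolP (e v u && (f u == Some c))) => [/andP[_ /eqP ->]|].
rewrite inE => /andP[/subsetP sX /indepP iX] ->.
split; last first.
  apply/eqP/ffunP => u; rewrite ffunE [paint c g X u]ffunE.
  case: (boolP (u \in X)) => uX.
    by have := sX u uX; rewrite inE => /and4P[-> /eqP-> _ _]; rewrite eqxx.
  by case: (boolP (e v u)) => //= /gN /negbTE ->.
apply: (clD f0) => // [|u vu]; last first.
  rewrite ffunE; case: (boolP (u \in X)) => [/sX|_].
    by rewrite inE (negbTE vu).
  by rewrite ffunE (negbTE vu).
apply/pproperP => u d; rewrite ffunE; case: (boolP (u \in X)) => uX.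
  move=> [<-]; have := sX u uX; rewrite inE => /and4P[vu _ cL /forallP hc].
  split=> // x ux; rewrite ffunE; case: (boolP (x \in X)) => xX.
    by have := iX _ _ uX xX; rewrite ux.
  by have /implyP := hc x; apply.
move=> gu; have [dL hd] := (pproperP _ pf0) _ _ (erase_eq gu).
split=> // x ux; rewrite ffunE; case: (boolP (x \in X)) => xX.
  apply/eqP => -[cd]; have := sX x xX; rewrite inE => /and4P[_ _ _ /forallP/(_ u)].
  by rewrite e_sym ux gu cd eqxx.
by apply/eqP => /erase_eq fx; have := hd x ux; rewrite fx eqxx.
Qed.

Lemma cls_paint v c f0 X : let g := erase v c f0 in
  X \subset paintable v c g -> cls v (paint c g X) c = X.
Proof.
move=> g /subsetP sX; apply/setP => u; rewrite inE ffunE.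
case: (boolP (u \in X)) => uX.
  by have := sX u uX; rewrite inE eqxx => /and4P[->].
rewrite ffunE; case: (boolP (e v u)) => //= vu.
by case: (eqVneq (f0 u) (Some c)) => //= /negbTE.
Qed.

(** * Exponential moments and the number of available colours *)

Local Open Scope ring_scope.

(* An exponential-moment weight for the number of occurrences of a colour around [v]:
   a product over the colours is small on average, but not when few colours are unused
   and few occur [b] times or more. *)
Definition weight (M b n : nat) : rat :=
  (2^-1) ^+ (n == 0)%N * (1 - M%:R^-1) ^+ (b <= n)%N.

(** As [0 < b], the two exponents are never both [1], so the product is affine in the two
    indicators. *)
Lemma weightE M b n : (0 < b)%N ->
  weight M b n = 1 - 2^-1 * (n == 0%N)%:R - M%:R^-1 * (b <= n)%N%:R.
Proof.
move=> b0; rewrite /weight; have [->|n0] := posnP n.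
  by rewrite leqn0 eqn0Ngt b0 /= expr0 expr1; lra.
by rewrite /= expr0; case: leqP => _ /=; rewrite ?expr1 ?expr0; lra.
Qed.

Lemma weight_ge0 M b n : (0 < M)%N -> 0 <= weight M b n.
Proof.
move=> M0; apply: mulr_ge0; apply: exprn_ge0; rewrite ?invr_ge0 //.
by rewrite subr_ge0 invf_le1 ?ltr0n // ler1n.
Qed.

(** The average of the weight is [1] minus half the probability of the empty set minus [1 / M] times
    that of size at least [b]. If [I] is small the first loss is at least [1 / (2 M)]; otherwise the
    second one is. *)
Lemma sum_weight_indeps (I : {set {set T}}) (M b : nat) : (0 < M)%N -> (0 < b)%N ->
  set0 \in I -> ((#|I| <= M)%N \/ (#|I| <= 2 * #|[set X in I | (b <= #|X|)%N]|)%N) ->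
  \sum_(X in I) weight M b #|X| <= (1 - (2 * M%:R)^-1) * #|I|%:R.
Proof.
move=> M0 b0 I0 hI.
under eq_bigr do rewrite weightE //.
rewrite !big_split /= !sumrN -!mulr_sumr.
have -> : \sum_(X in I) (#|X| == 0%N)%:R = 1 :> rat.
  rewrite (bigD1 set0) //= cards0 eqxx big1 ?addr0 // => X /andP[_ X0].
  by rewrite cards_eq0 (negbTE X0).
have -> : \sum_(X in I) (b <= #|X|)%N%:R = #|[set X in I | (b <= #|X|)%N]|%:R :> rat.
  rewrite -natr_sum -sum1_card; congr (_%:R).
  by rewrite -big_mkcondr; apply: eq_bigl => X; rewrite inE.
rewrite sumr_const.
have M0' : 0 < M%:R :> rat by rewrite ltr0n.
set B := #|[set X in I | _]|%:R.
have B0 : 0 <= B by rewrite ler0n.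
set n := #|I|%:R.
have : (2 * M%:R)^-1 * n <= 2^-1 * 1 + M%:R^-1 * B.
  rewrite invfM -[X in X <= _]mulrA -[M%:R^-1 * B]mul1r.
  have Mi : 0 <= M%:R^-1 :> rat by rewrite invr_ge0 ltW.
  case: hI => [nM|nB].
    apply: (@le_trans _ _ (2^-1 * 1)); last by rewrite lerDl mul1r mulr_ge0.
    by rewrite ler_pM2l // mulrC ler_pdivrMr // mul1r ler_nat.
  have hB : n <= 2 * B by rewrite /n /B -natrM ler_nat.
  apply: (@le_trans _ _ (2^-1 * (M%:R^-1 * (2 * B)))).
    by rewrite ler_pM2l // ler_wpM2l.
  have -> : 2^-1 * (M%:R^-1 * (2 * B)) = 1 * (M%:R^-1 * B) by field; rewrite lt0r_neq0.
  by rewrite lerDr.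
rewrite mulrBl mul1r => h.
by rewrite -[n]/(n) -mulr_natl mulr1 -/n; lra.
Qed.

(** Treat the colours one at a time. On a fibre of [erase v c] the factors of the other colours are
    constant, while the factor of [c] averages to at most [1 - 1 / (2 M)]. *)
Lemma sum_prod_weight v D w b (s : seq K) :
  let M := ((4 * w) ^ (6 * (b * b)))%N in
  (0 < w)%N -> (0 < b)%N -> (forall A, clique e A -> (#|A| <= w)%N) ->
  closed_at v D -> uniq s ->
  \sum_(f in D) \prod_(c <- s) weight M b #|cls v f c|
    <= (1 - (2 * M%:R)^-1) ^+ size s * #|D|%:R.
Proof.
move=> M w0 b0 hw clD.
have M0 : (0 < M)%N by rewrite expn_gt0; lia.
elim: s => [_|c s IH].
  rewrite expr0 mul1r; under eq_bigr do rewrite big_nil.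
  by rewrite sumr_const.
rewrite /= => /andP[cs Us].
pose P f := \prod_(d <- s) weight M b #|cls v f d|.
have PE f : P (erase v c f) = P f.
  apply: eq_big_seq => d ds; rewrite cls_erase //.
  by apply: contraNneq cs => <-.
have P0 f : 0 <= P f by apply: prodr_ge0 => d _; exact: weight_ge0.
pose rho : rat := 1 - (2 * M%:R)^-1.
have rho0 : 0 <= rho.
  rewrite subr_ge0 invf_le1 -?natrM ?ler1n ?ltr0n; lia.
suff : \sum_(f in D) weight M b #|cls v f c| * P f <= rho * \sum_(f in D) P f.
  move=> h; under eq_bigr do rewrite big_cons.
  apply: le_trans h _; rewrite exprS -mulrA ler_wpM2l //.
  exact: IH.
rewrite (partition_big (erase v c) predT) //= [X in _ * X](partition_big (erase v c) predT) //=.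
rewrite mulr_sumr; apply: ler_sum => g _.
have -> : \sum_(f in D | erase v c f == g) P f = P g * #|[set f in D | erase v c f == g]|%:R.
  rewrite -sum1_card natr_sum mulr_sumr; apply: eq_big => [f|f /andP[_ /eqP<-]].
    by rewrite inE.
  by rewrite PE mulr1.
have -> : \sum_(f in D | erase v c f == g) weight M b #|cls v f c| * P f =
    P g * \sum_(f in [set f in D | erase v c f == g]) weight M b #|cls v f c|.
  rewrite mulr_sumr; apply: eq_big => [f|f /andP[_ /eqP<-]]; first by rewrite inE.
  by rewrite PE mulrC.
rewrite mulrCA ler_wpM2l //.
have [->|[f0]] := set_0Vmem [set f in D | erase v c f == g].
  by rewrite big_set0 cards0 mulr0.
rewrite inE => /andP[f0D /eqP <-]; rewrite erase_fiber //.
set g0 := erase v c f0; set W := paintable v c g0.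
have cp X : X \in indeps e W -> cls v (paint c g0 X) c = X.
  by rewrite inE => /andP[sX _]; exact: cls_paint.
have inj : {in indeps e W &, injective (paint c g0)}.
  by move=> X Y hX hY hXY; rewrite -(cp X) // hXY cp.
rewrite big_imset //= card_in_imset //.
rewrite (eq_bigr (fun X => weight M b #|X|)); last by move=> X /cp ->.
apply: sum_weight_indeps => //; first exact: set0_indeps.
exact: indeps_few_or_large.
Qed.

Lemma card_few_avail v D w b t h :
  let M := ((4 * w) ^ (6 * (b * b)))%N in
  (0 < w)%N -> (0 < b)%N -> (forall A, clique e A -> (#|A| <= w)%N) ->
  closed_at v D -> (#|nbr v| < h.+1 * b)%N ->
  #|[set f in D | (#|avail f v| < 2 * t)%N]|%:R *
     ((2^-1) ^+ (2 * t) * (1 - M%:R^-1) ^+ h)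
    <= (1 - (2 * M%:R)^-1) ^+ #|L v| * #|D|%:R :> rat.
Proof.
move=> M w0 b0 hw clD hh.
have M0 : (0 < M)%N by rewrite expn_gt0; lia.
have := sum_prod_weight w0 b0 hw clD (enum_uniq (L v)).
rewrite -cardE; apply: le_trans.
rewrite -/M [X in _ <= X](bigID (fun f => #|avail f v| < 2 * t)%N) /=.
rewrite -[X in X <= _]addr0; apply: lerD; last first.
  by apply: sumr_ge0 => f _; apply: prodr_ge0 => c _; exact: weight_ge0.
rewrite mulrC -sum1_card natr_sum mulr_sumr.
rewrite [X in X <= _](eq_bigl (fun f => (f \in D) && (#|avail f v| < 2 * t)%N)); last first.
  by move=> f; rewrite inE.
apply: ler_sum => f /andP[_ ft]; rewrite mulr1.
rewrite big_split /= !prodrXr !big_enum /=.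
have hM : 0 <= 1 - M%:R^-1 :> rat.
  by rewrite subr_ge0 invf_le1 ?ltr0n // ler1n.
have Mi : 0 <= M%:R^-1 :> rat by rewrite invr_ge0 ler0n.
apply: ler_pM; rewrite ?exprn_ge0 //.
  apply: ler_wiXn2l => //; apply: leq_trans (ltnW ft); apply: eq_leq.
  rewrite -sum1_card -big_mkcondr; apply: eq_bigl => c; rewrite !inE.
  congr (_ && _); rewrite cards_eq0; apply/eqP/forallP => [h0 u|h0].
    by apply/implyP => vu; have /setP/(_ u) := h0; rewrite !inE vu => /negbT.
  apply/setP => u; rewrite !inE; apply/negbTE; rewrite negb_and -implybE.
  exact: h0.
apply: ler_wiXn2l; rewrite ?gerBl //.
(* Pigeonhole: colours seen at least [b] times occupy disjoint sets of [b] neighbours, so at most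
   [h] of them fit. *)
rewrite -ltnS -(ltn_pmul2r b0); apply: leq_ltn_trans hh.
rewrite big_distrl /=.
apply: leq_trans (sum_card_fiber_le (nbr v) [set Some c | c in L v] f).
rewrite big_imset /=; last by move=> c d _ _ [].
apply: leq_sum => c _; case: (leqP b #|cls v f c|) => hb; rewrite ?mul0n // mul1n.
apply: leq_trans hb _; apply: subset_leq_card; apply/subsetP => u.
by rewrite !inE.
Qed.

(** * Bad events and existence of a colouring *)

Lemma avail_local f g u : (forall x, e u x -> f x = g x) -> avail f u = avail g u.
Proof.
move=> fg; apply/setP => c; rewrite !inE; congr (_ && _).
by apply: eq_forallb => x; case: (boolP (e u x)) => //= /fg ->.
Qed.

(** The second clause counts only blank neighbours with many available colours, as only these are
    shown to be rare; when no vertex is bad the restriction is void. *)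
Definition bad t v f := (#|avail f v| < 2 * t)%N ||
  (t <= #|[set u in blanks f v | (2 * t <= #|avail f u|)%N]|)%N.

(** [bad t u f] reads [f] only at the neighbours of [u] and at their neighbours; the relation says
    that one of these is adjacent to [v]. *)
Definition within3 v u := [exists x, e u x && (e v x || [exists y, e x y && e v y])].

Lemma bad_far t v u f g : ~~ within3 v u -> (forall x, ~~ e v x -> f x = g x) ->
  bad t u f = bad t u g.
Proof.
move=> /existsPn far fg.
have h1 x : e u x -> f x = g x.
  by move=> ux; apply: fg; have := far x; rewrite ux negb_or => /andP[].
have h2 x y : e u x -> e x y -> f y = g y.
  move=> ux xy; apply: fg; have := far x; rewrite ux negb_or => /andP[_ /existsPn/(_ y)].
  by rewrite xy.
rewrite /bad (avail_local h1); congr (_ || (_ <= #|pred_of_set _|)%N).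
apply/setP => x; rewrite !inE; case: (boolP (e u x)) => //= ux.
by rewrite h1 // (@avail_local f g x) // => y; exact: h2.
Qed.

Lemma card_within3 Delta v : (forall x, #|nbr x| <= Delta)%N ->
  (#|[set u | within3 v u]| <= Delta ^ 2 + Delta ^ 3)%N.
Proof.
move=> hD.
have bnd (F : T -> {set T}) x n : (forall y, #|F y| <= n)%N ->
    (#|\bigcup_(y in nbr x) F y| <= Delta * n)%N.
  move=> hF; apply: leq_trans (card_bigcup_le _ _) _.
  apply: leq_trans (leq_sum _ (fun y _ => hF y)) _.
  by rewrite sum_nat_const leq_mul.
have sub : [set u | within3 v u] \subset (\bigcup_(x in nbr v) nbr x) :|:
    \bigcup_(y in nbr v) \bigcup_(x in nbr y) nbr x.
  apply/subsetP => u; rewrite inE => /existsP[x /andP[ux /orP[vx|/existsP[y /andP[xy vy]]]]].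
    by apply/setUP; left; apply/bigcupP; exists x; rewrite !inE // e_sym.
  apply/setUP; right; apply/bigcupP; exists y; first by rewrite inE.
  by apply/bigcupP; exists x; rewrite !inE e_sym.
apply: leq_trans (subset_leq_card sub) _.
apply: leq_trans (leq_card_setU _ _) _.
rewrite !expnS expn0 muln1; apply: leq_add; first exact: (bnd).
by apply: (bnd) => y; exact: (bnd).
Qed.

Lemma exists_list_coloring Delta w b k t h :
  let M := ((4 * w) ^ (6 * (b * b)))%N in
  (0 < w)%N -> (0 < b)%N -> (forall A, clique e A -> (#|A| <= w)%N) ->
  (forall v, #|nbr v| <= Delta)%N -> (forall v, k <= #|L v|)%N ->
  (8 <= Delta)%N -> (0 < t)%N -> (Delta < h.+1 * b)%N ->
  ('C(Delta, t) * (2 * Delta ^ 4) <= t ^ t)%N ->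
  (2 * Delta ^ 4)%:R * (1 - (2 * M%:R)^-1) ^+ k
     <= (2^-1) ^+ (2 * t) * (1 - M%:R^-1) ^+ h :> rat ->
  exists g : T -> K, (forall v, g v \in L v) /\ (forall u v, e u v -> g u <> g v).
Proof.
move=> M w0 b0 hw hD hk D8 t0 hh numC numB.
have M1 : (1 < M)%N.
  by rewrite /M -[1%N](expn0 (4 * w)) ltn_exp2l //; lia.
have closed_bad v D : closed_at v D ->
    (Delta ^ 4 * #|[set f in D | bad t v f]| <= #|D|)%N.
  move=> clD.
  set B := [set f in D | (#|avail f v| < 2 * t)%N].
  set C := [set f in D | (t <= #|[set u in blanks f v | (2 * t <= #|avail f u|)%N]|)%N].
  have sub : (#|[set f in D | bad t v f]| <= #|B| + #|C|)%N.
    apply: leq_trans (leq_card_setU _ _); apply: subset_leq_card.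
    by apply/subsetP => f; rewrite !inE => /andP[-> bf]; exact: bf.
  have hB : (2 * Delta ^ 4 * #|B| <= #|D|)%N.
    have := @card_few_avail v D w b t h w0 b0 hw clD (leq_ltn_trans (hD v) hh).
    rewrite -/M -/B; set q : rat := _ * _ ^+ h => hq.
    have q0 : 0 < q.
      apply: mulr_gt0; apply: exprn_gt0; rewrite ?invr_gt0 //.
      by rewrite subr_gt0 invf_lt1 ?ltr0n ?ltr1n // ltnW.
    rewrite -(ler_nat rat) -(ler_pM2r q0) natrM -mulrA.
    apply: le_trans (ler_wpM2l (ler0n _ _) hq) _.
    rewrite mulrA [X in _ <= X]mulrC; apply: ler_wpM2r; first exact: ler0n.
    apply: le_trans numB; apply: ler_wpM2l; first exact: ler0n.
    apply: ler_wiXn2l => //; rewrite ?gerBl ?subr_ge0 ?invr_ge0 -?natrM ?ler0n //.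
    by rewrite invf_le1 ?ler1n ?ltr0n; lia.
  have hC : (2 * Delta ^ 4 * #|C| <= #|D|)%N.
    have := card_many_blank_nbrs t clD; rewrite -/C => h1.
    have tt : (0 < t ^ t)%N by rewrite expn_gt0 t0.
    have h2 : ('C(#|nbr v|, t) <= 'C(Delta, t))%N by apply: leq_bin2l; exact: hD.
    rewrite -(leq_pmul2r tt) -mulnA.
    apply: leq_trans (_ : 2 * Delta ^ 4 * ('C(Delta, t) * #|D|) <= _)%N.
      by rewrite leq_mul // (leq_trans h1) // leq_mul.
    by rewrite mulnA [X in (X * _ <= _)%N]mulnC [X in (_ <= X)%N]mulnC leq_mul.
  by nia.
pose O := [set f | pproper f].
have O0 : (0 < #|O|)%N.
  apply/card_gt0P; exists [ffun=> None]; rewrite inE; apply/pproperP => u c.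
  by rewrite ffunE.
have [|v|||f] := @lopsided_local_lemma _ _ O (bad t) within3 (Delta ^ 2 + Delta ^ 3) (Delta ^ 4)
  _ _ _ _ O0.
(* Avoiding bad events that are not near [v] is unaffected by recolouring around [v], so the
   conditioned set is again closed at [v]. *)
- move=> v S hS; apply: closed_bad; split.
    by apply/subsetP => f; rewrite inE => /andP[].
  move=> f g; rewrite !inE => /andP[_ /forall_inP hf] -> fg /=.
  apply/forall_inP => u uS; rewrite -(bad_far t (hS u uS) fg); exact: hf.
- exact: card_within3.
- have := D8; clear; rewrite !expnS expn0 => h; nia.
- by apply: leq_trans (_ : 8 ^ 4 <= _)%N; rewrite // leq_exp2r.
rewrite inE => pf hf; apply: (greedy_extension pf) => v _.
have := hf v; rewrite /bad negb_or -leqNgt -ltnNge => /andP[av].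
(* No vertex is bad, so every blank neighbour is counted: [v] has fewer than [t] of them against
   [2 * t] available colours. *)
rewrite (_ : [set u in _ | _] = blanks f v) => [|]; first by lia.
apply/setP => u; rewrite inE; case: (u \in blanks f v) => //=.
by have := hf u; rewrite /bad negb_or -leqNgt => /andP[].
Qed.

End PartialColorings.

(** * Numerical estimates *)

(** Pair each factor of the factorial with its mirror image: [(i + 1) * (n - i) >= n] for
    [i < n]. *)
Lemma expn_le_fact2 n : n ^ n <= (n`!) ^ 2.
Proof.
rewrite fact_prod big_add1 /= big_mkord -mulnn.
rewrite [X in _ * X](reindex_inj rev_ord_inj) -big_split /=.
rewrite -[X in _ ^ X <= _](card_ord n) -prod_nat_const.
by apply: leq_prod => i _; have := ltn_ord i; nia.
Qed.

Lemma expn8_le_exp2 n : 48 <= n -> n ^ 8 <= 2 ^ n.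
Proof.
have h m : 6 <= m -> 8 * m.+1 <= 2 ^ m.
  elim: m => // m IH; rewrite leq_eqVlt => /orP[/eqP<- //|/IH {IH}].
  by rewrite [2 ^ m.+1]expnS; lia.
move=> n48; have /h h1 : 6 <= n %/ 8 by lia.
apply: leq_trans (_ : (2 ^ (n %/ 8)) ^ 8 <= _); first by rewrite leq_exp2r //; lia.
by rewrite -expnM leq_exp2l //; lia.
Qed.

(** Bound the binomial by [Delta ^ t / t!], then square and use [t ^ t <= t! ^ 2]: it suffices that
    [Delta ^ (2 t + 9) <= t ^ (3 t)]. In fourth powers, [8 t + 36 <= 9 t] lets [Delta ^ 3 <= t ^ 4]
    conclude. *)
Lemma bin_mul_le Delta t : 4 <= Delta -> 36 <= t -> Delta ^ 3 <= t ^ 4 ->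
  'C(Delta, t) * (2 * Delta ^ 4) <= t ^ t.
Proof.
move=> D4 t36 Dt.
have f0 : 0 < t`! by rewrite fact_gt0.
rewrite -(leq_pmul2r f0) mulnAC bin_ffact.
have hff : Delta ^_ t <= Delta ^ t.
  rewrite ffact_prod -[X in _ <= _ ^ X](card_ord t) -prod_nat_const.
  by apply: leq_prod => i _; lia.
apply: leq_trans (leq_mul hff (leqnn _)) _.
rewrite -(@leq_exp2r _ _ 2) // [X in _ <= X]expnMn.
apply: leq_trans (leq_mul (leqnn _) (expn_le_fact2 t)).
apply: leq_trans (_ : Delta ^ (2 * t + 9) <= _).
  rewrite expnMn [(2 * _) ^ 2]expnMn -!expnM mulnCA.
  rewrite [Delta ^ (2 * t + 9)](_ : _ = Delta * (Delta ^ (t * 2) * Delta ^ (4 * 2))).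
    by apply: leq_mul.
  by rewrite -expnD -expnS; congr (_ ^ _); lia.
rewrite -expnM -expnD -(@leq_exp2r _ _ 4) // -!expnM.
apply: leq_trans (_ : Delta ^ (3 * (3 * t)) <= _); first by rewrite leq_exp2l; lia.
rewrite [(t * 2 + t) * 4](_ : _ = 4 * (3 * t)); last by lia.
by rewrite [Delta ^ _]expnM [t ^ _]expnM leq_exp2r; lia.
Qed.

Local Open Scope ring_scope.

Lemma bernoulli_le (F : realFieldType) (x : F) n : 0 <= x -> 1 + n%:R * x <= (1 + x) ^+ n.
Proof.
move=> x0; elim: n => [|n IH]; first by rewrite expr0 mul0r addr0.
rewrite exprS; apply: le_trans (ler_wpM2l _ IH); last by rewrite addr_ge0.
rewrite -natr1; have : 0 <= n%:R * x * x by rewrite !mulr_ge0.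
nra.
Qed.

(** With [x = 1 / n], Bernoulli gives [(1 + x) ^ n >= 2], and [(1 - x) ^ n * (1 + x) ^ n <= 1]. *)
Lemma exp_one_sub_inv_le (n : nat) : (0 < n)%N -> (1 - n%:R^-1) ^+ n <= 2^-1 :> rat.
Proof.
move=> n0; set x : rat := n%:R^-1.
have x0 : 0 <= x by rewrite invr_ge0.
have x1 : x <= 1 by rewrite invf_le1 ?ltr0n // ler1n.
have h2 : 2 <= (1 + x) ^+ n.
  by have := bernoulli_le n x0; rewrite mulfV ?pnatr_eq0 -?lt0n.
have h1 : (1 - x) ^+ n * (1 + x) ^+ n <= 1.
  rewrite -exprMn; apply: exprn_ile1; nra.
have h3 : 0 <= (1 - x) ^+ n by rewrite exprn_ge0 // subr_ge0.
nra.
Qed.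

(** Split [k >= 2 M * 4 t + 4 h]. The first block yields [2 ^ - (4 t)], half of whose exponent pays
    for [2 * Delta ^ 4]; the second yields [(1 - 1 / M) ^ h]. *)
Lemma weights_numerics (Delta k t M h : nat) : (1 < M)%N ->
  (16 * M * t <= k)%N -> (8 * h <= k)%N -> (Delta ^ 4 <= 2 ^ t)%N -> (0 < t)%N ->
  (2 * Delta ^ 4)%:R * (1 - (2 * M%:R)^-1) ^+ k
     <= (2^-1) ^+ (2 * t) * (1 - M%:R^-1) ^+ h :> rat.
Proof.
move=> M1 tk hk Dt t0.
have MR : 2 <= M%:R :> rat by rewrite ler_nat.
set y : rat := (2 * M%:R)^-1.
have My : M%:R^-1 = 2 * y by rewrite /y; field; lra.
have y0 : 0 <= y by rewrite invr_ge0; lra.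
have y4 : y <= 4^-1 by rewrite lef_pV2 ?posrE; lra.
set r := 1 - y.
have r0 : 0 <= r by rewrite /r; lra.
have r1 : r <= 1 by rewrite /r; lra.
(* The square [1 - 2 * y + y ^ 2] would just miss the bound [1 - 2 * y]; the fourth power leaves
   room. *)
have hr4 : r ^+ 4 <= 1 - M%:R^-1 by rewrite My /r !exprS expr0; nra.
have q0 : 0 <= 1 - M%:R^-1 :> rat := le_trans (exprn_ge0 4 r0) hr4.
have hr2 : r ^+ (2 * M) <= 2^-1.
  by have := @exp_one_sub_inv_le (2 * M); rewrite natrM; apply; lia.
have step1 : r ^+ k <= (2^-1) ^+ (4 * t) * (1 - M%:R^-1) ^+ h.
  apply: (@le_trans _ _ (r ^+ (2 * M * (4 * t) + 4 * h))).
    by apply: ler_wiXn2l => //; lia.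
  rewrite exprD [r ^+ (2 * M * _)]exprM [r ^+ (4 * h)]exprM; apply: ler_pM; rewrite ?exprn_ge0 //.
    by apply: lerXn2r; rewrite ?nnegrE ?exprn_ge0 // invr_ge0.
  by apply: lerXn2r; rewrite ?nnegrE ?exprn_ge0.
have h0 : 0 <= (1 - M%:R^-1) ^+ h :> rat.
  exact: exprn_ge0.
apply: le_trans (ler_wpM2l (ler0n _ _) step1) _.
rewrite mulrA; apply: ler_wpM2r => //.
have -> : (4 * t = 2 * t + 2 * t)%N by lia.
rewrite exprD mulrA -[X in _ <= X]mul1r; apply: ler_wpM2r; first by rewrite exprn_ge0 ?invr_ge0.
rewrite exprVn ler_pdivrMr ?exprn_gt0 // mul1r -natrX ler_nat.
apply: leq_trans (_ : 2 ^ t * 2 ^ t <= _)%N; last by rewrite -expnD leq_exp2l //; lia.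
by rewrite leq_mul // -[X in (X <= _)%N]expn1 leq_exp2l.
Qed.

(** * Choosability bounds and the choice of parameters *)

Lemma nbr_card_le (G : sgraph) (Delta : nat) : (max_degree G <= Delta)%N ->
  forall v : G, (#|nbr (@adj G) v| <= Delta)%N.
Proof. by move=> h v; apply: leq_trans h; rewrite /max_degree (bigD1 v) //= leq_maxl. Qed.

Lemma choosable_degree (G : sgraph) (Delta : nat) : (max_degree G <= Delta)%N ->
  choosable G Delta.+1.
Proof.
move=> /nbr_card_le hD K L hL.
apply: (@greedy_extension _ _ (@adj G) L (@adj_sym G) (@adj_irrefl G) [ffun=> None]).
  by apply/pproperP => u c; rewrite ffunE.
move=> v _; rewrite (_ : avail _ _ _ v = L v); last first.
  apply/setP => c; rewrite inE; case: (c \in L v) => //=.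
  by apply/forallP => u; apply/implyP => _; rewrite ffunE.
apply: leq_trans (hL v); rewrite ltnS; apply: leq_trans (hD v).
by apply: subset_leq_card; apply/subsetP => u; rewrite !inE => /andP[].
Qed.

(** The exponent [120 = 20 * 6] makes [M ^ 20 <= Delta]. With [t = k / (16 M)] rounded down,
    [Delta <= M ^ 3 * t]; since [M ^ 12 <= Delta], this gives [Delta ^ 3 <= t ^ 4], as [bin_mul_le]
    requires. *)
Lemma choosable_small_cliques (G : sgraph) (Delta w b k : nat) :
  (0 < w)%N -> (0 < b)%N -> ((4 * w) ^ (120 * (b * b)) <= Delta)%N ->
  (8 * Delta <= k * b)%N -> (max_degree G <= Delta)%N ->
  (forall A : {set G}, is_clique A -> (#|A| <= w)%N) -> choosable G k.
Proof.
move=> w0 b0 hDelta hkb /nbr_card_le hD hw K L hL.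
have [M ME] : {M | M = ((4 * w) ^ (6 * (b * b)))%N} by exists ((4 * w) ^ (6 * (b * b)))%N.
have bb : (b <= b * b)%N by rewrite leq_pmulr.
have M64 : (64 <= M)%N.
  rewrite ME; apply: leq_trans (_ : 4 ^ 6 <= _)%N => //.
  by apply: leq_trans (_ : (4 * w) ^ 6 <= _)%N; rewrite ?leq_exp2r ?leq_exp2l //; lia.
have bM : (b <= M)%N.
  rewrite ME; apply: leq_trans (ltnW (ltn_expl b (_ : 1 < 4 * w)%N)) _; first lia.
  by rewrite leq_exp2l //; lia.
have M20 : (M ^ 20 <= Delta)%N.
  by rewrite ME -expnM (leq_trans _ hDelta) // leq_exp2l; lia.
pose t := (k %/ (16 * M))%N; pose h := (k %/ 8)%N.
have tk : (16 * M * t <= k)%N by rewrite mulnC leq_trunc_div.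
have M0 : (0 < M)%N by apply: leq_trans M64.
have kt : (k < 16 * M * t.+1)%N by rewrite mulnC ltn_ceil // muln_gt0 M0.
have hk : (8 * h <= k)%N by rewrite mulnC leq_trunc_div.
have kh : (k < 8 * h.+1)%N by rewrite mulnC ltn_ceil.
clearbody t h.
have kM : (8 * Delta <= k * M)%N by apply: leq_trans hkb _; rewrite leq_mul.
have Dt : (Delta < 2 * (M * M) * t.+1)%N.
  rewrite -(ltn_pmul2l (_ : 0 < 8)%N) //; apply: leq_ltn_trans kM _.
  have -> : (8 * (2 * (M * M) * t.+1) = 16 * M * t.+1 * M)%N by lia.
  by rewrite ltn_pmul2r //; lia.
have M3 : (M ^ 3 <= M ^ 20)%N by rewrite leq_exp2l //; lia.
have M3E : (M ^ 3 = M * (M * M))%N by rewrite !expnS expn0 muln1.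
have t0 : (0 < t)%N.
  rewrite lt0n; apply/negP => /eqP t0; rewrite t0 in Dt.
  have : (4 * (M * M) <= M * (M * M))%N by rewrite leq_mul //; lia.
  lia.
have Dt3 : (Delta <= M ^ 3 * t)%N.
  apply: leq_trans (ltnW Dt) _; rewrite M3E.
  apply: leq_trans (_ : 2 * (M * M) * (2 * t) <= _)%N; first by rewrite leq_mul //; lia.
  by rewrite mulnA leq_mul // mulnAC leq_mul //; lia.
have D0 : (0 < Delta)%N by apply: leq_trans M20; rewrite expn_gt0; lia.
have Dt4 : (Delta ^ 3 <= t ^ 4)%N.
  rewrite -(leq_pmul2l D0) -expnS.
  apply: leq_trans (_ : (M ^ 3 * t) ^ 4 <= _)%N; first by rewrite leq_exp2r.
  by rewrite expnMn leq_mul // -expnM (leq_trans _ M20) // leq_exp2l //; lia.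
have tM : (M <= t)%N.
  have M30 : (0 < M ^ 3)%N by rewrite expn_gt0; lia.
  rewrite -(leq_pmul2l M30) -expnSr (leq_trans _ Dt3) // (leq_trans _ M20) //.
  by rewrite leq_exp2l //; lia.
have DM : (M <= Delta)%N.
  by apply: leq_trans M20; rewrite -[X in (X <= _)%N]expn1 leq_exp2l //; lia.
have Dt2 : (Delta <= t ^ 2)%N.
  rewrite leqNgt; apply/negP => h2.
  have : (t ^ 4 < Delta ^ 3)%N.
    apply: leq_trans (_ : Delta ^ 2 <= _)%N; last by rewrite leq_exp2l //; lia.
    by rewrite -[4%N]/(2 * 2)%N expnM ltn_exp2r.
  by rewrite ltnNge Dt4.
apply: (@exists_list_coloring _ _ (@adj G) L (@adj_sym G) (@adj_irrefl G) Delta w b k t h) => //.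
- move=> A /cliqueP cA; apply: hw => u v uA vA; exact: cA.
- lia.
- rewrite -(ltn_pmul2l (_ : 0 < 8)%N) //; apply: leq_ltn_trans hkb _.
  by rewrite mulnA ltn_pmul2r.
- by apply: bin_mul_le => //; lia.
- rewrite -ME; apply: weights_numerics => //; first by lia.
  apply: leq_trans (_ : (t ^ 2) ^ 4 <= _)%N; first by rewrite leq_exp2r.
  by rewrite -expnM expn8_le_exp2 //; lia.
Qed.

Lemma list_chromatic_number_le (G : sgraph) k : choosable G k ->
  (list_chromatic_number G <= k)%N.
Proof.
by move=> ck; rewrite /list_chromatic_number; case: ex_minnP => m _; apply; apply/boolp.asboolP.
Qed.

(** Maximality makes [b] of order the square root of [ln Delta / ln w]. The value [0] can occur and
    is handled separately, by [choosable_degree]. *)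
Lemma exists_max_exponent (Delta w : nat) : (0 < Delta)%N -> (0 < w)%N ->
  exists b, ((4 * w) ^ (120 * (b * b)) <= Delta)%N /\
    (Delta < (4 * w) ^ (120 * (b.+1 * b.+1)))%N.
Proof.
move=> D0 w0; pose P b := ((4 * w) ^ (120 * (b * b)) <= Delta)%N.
have exP : exists b, P b by exists 0%N; rewrite /P muln0 expn0.
have bound b : P b -> (b <= Delta)%N.
  apply: leq_trans; apply: leq_trans (_ : (4 * w) ^ b <= _)%N.
    by apply/ltnW/ltn_expl; lia.
  by rewrite leq_exp2l; nia.
case: (ex_maxnP exP bound) => b Pb maxb; exists b; split=> //.
by rewrite ltnNge; apply/negP => /maxb; rewrite ltnn.
Qed.

Lemma ln_le_of_lt_exp (R : realType) (Delta w n : nat) : (0 < Delta)%N -> (2 <= w)%N ->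
  (Delta < (4 * w) ^ n)%N -> ln (Delta%:R : R) <= (3 * n)%:R * ln (w%:R : R).
Proof.
move=> D0 w2 h; have w0 : (0 < w)%N by apply: leq_trans w2.
(* For [w >= 2] one has [4 * w <= w ^ 3]. *)
have h' : (Delta <= w ^ (3 * n))%N.
  apply: leq_trans (ltnW h) _; rewrite expnM; case: (n) => // m.
  by rewrite leq_exp2r // !expnS expn0; nia.
rewrite mulr_natl -lnXn ?ltr0n //.
by rewrite ler_ln ?posrE ?exprn_gt0 ?ltr0n // -natrX ler_nat.
Qed.

Theorem theorem1p6 (R : realType) :
  exists C : R, 0 < C /\
    forall Delta omega : nat, (2 <= Delta)%N -> (2 <= omega)%N ->
    forall G : sgraph, (max_degree G <= Delta)%N ->
      (forall A : {set G}, is_clique A -> (#|A| <= omega)%N) ->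
      (list_chromatic_number G)%:R
        <= C * Delta%:R * Num.sqrt (ln (omega%:R : R) / ln (Delta%:R : R)).
Proof.
(* The two cases below need [2 * 19 = 38] and [9 * 38 = 342]. *)
exists 400; split=> // Delta w D2 w2 G hD hw.
have D0 : (0 < Delta)%N by apply: leq_trans D2.
have w0 : (0 < w)%N by apply: leq_trans w2.
have lnD : 0 < ln (Delta%:R : R) by rewrite ln_gt0 // ltr1n.
set x := ln _ / ln _.
have sqrt_ge (m : nat) : (0 < m)%N -> ln (Delta%:R : R) <= (m * m)%:R * ln (w%:R : R) ->
    1 <= m%:R * Num.sqrt x.
  move=> m0 hm; have m0' : 0 < m%:R :> R by rewrite ltr0n.
  rewrite -ler_pdivrMl // mulr1 -[m%:R^-1]gtr0_norm ?invr_gt0 // -sqrtr_sqr.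
  apply: ler_wsqrtr; rewrite /x ler_pdivlMr // exprVn ler_pdivrMl ?exprn_gt0 //.
  by rewrite -natrX -mulnn.
have [b [Pb maxb]] := exists_max_exponent D0 w0.
have hln := ln_le_of_lt_exp R D0 w2 maxb.
have lnw : 0 <= ln (w%:R : R) by apply: ln_ge0; rewrite ler1n.
have Dx : 0 <= Delta%:R * Num.sqrt x by rewrite mulr_ge0 // sqrtr_ge0.
case: (posnP b) => [b0|b0].
  (* [19 ^ 2 = 361] exceeds [3 * 120]. *)
  have h1 : 1 <= 19%:R * Num.sqrt x.
    apply: sqrt_ge => //; apply: le_trans hln _; rewrite b0.
    by rewrite ler_wpM2r // ler_nat.
  have := list_chromatic_number_le (choosable_degree hD).
  rewrite -(ler_nat R) => h2; apply: le_trans h2 _.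
  have h3 : Delta.+1%:R <= 2 * Delta%:R :> R by rewrite -natrM ler_nat; lia.
  apply: le_trans h3 _.
  have : Delta%:R * 1 <= Delta%:R * (19%:R * Num.sqrt x) by rewrite ler_wpM2l.
  by rewrite mulr1; nra.
(* As [b.+1 <= 2 * b], [360 * b.+1 ^ 2 <= 1440 * b ^ 2 <= (38 * b) ^ 2]. *)
have h1 : 1 <= (38 * b)%:R * Num.sqrt x.
  apply: sqrt_ge; first by rewrite muln_gt0.
  apply: le_trans hln _; rewrite ler_wpM2r // ler_nat; nia.
(* The successor makes up for rounding down; it adds [b <= Delta] to [k * b], whence the factor
   [9]. *)
pose k := (8 * Delta %/ b).+1.
have hk : (8 * Delta <= k * b)%N by apply: ltnW; rewrite ltn_ceil.
have bD : (b <= Delta)%N.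
  apply: leq_trans Pb; apply: leq_trans (_ : (4 * w) ^ b <= _)%N.
    by apply/ltnW/ltn_expl; lia.
  by rewrite leq_exp2l; nia.
have kb : (k * b <= 9 * Delta)%N.
  by rewrite /k mulSn; have := leq_trunc_div (8 * Delta) b; lia.
have := list_chromatic_number_le (choosable_small_cliques w0 b0 Pb hk hD hw).
rewrite -(ler_nat R) => h2; apply: le_trans h2 _.
have h3 : k%:R * 1 <= k%:R * ((38 * b)%:R * Num.sqrt x) by rewrite ler_wpM2l.
rewrite mulr1 in h3; apply: le_trans h3 _; rewrite mulrA.
apply: ler_wpM2r; first exact: sqrtr_ge0.
by rewrite -!natrM ler_nat; nia.
Qed.
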